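(* Let $E$ be a Banach space, let $\Lambda$ be a well ordered subset of a real interval $[a,b)$, $-\infty<a<b\le\infty$, with $\min\Lambda=a$ and $\sup\Lambda=b$, and such that $[a,b)$ is the union of the disjoint intervals $[\alpha,S(\alpha))$, $\alpha\in\Lambda$. Let $(z_\alpha)_{\alpha\in\Lambda}$ be a family in $E$ and let $g:[a,b)\to E$ be the step mapping defined by $g(t)=z_\alpha$ for $t\in[\alpha,S(\alpha))$, $\alpha\in\Lambda$. Then the following conditions are equivalent: (a) $g$ is locally HL integrable. (b) The family $((S(\alpha)-\alpha)z_\alpha)_{\alpha\in\Lambda}$ is locally summable. If (a) or (b) holds and $c\in(a,b)$, then $\int_a^cg(t)\,dt=f(c)$, where $f:[a,b)\to E$ is defined by $$f(t)=\sigma(\gamma)+(t-\gamma)z_\gamma,\quad t\in[\gamma,S(\gamma)),\ \gamma\in\Lambda,$$ and $\sigma(\gamma)$ denotes the sum of the family $((S(\alpha)-\alpha)z_\alpha)_{\alpha\in\Lambda^{<\gamma}}$.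
   Context: A subset $\Lambda$ of $\mathbb R\cup\{\infty\}$ is well ordered if each of its nonempty subsets has a smallest element. For $\beta\in\Lambda$ different from a possible maximum of $\Lambda$, $S(\beta)$ is the smallest element of $\Lambda$ greater than $\beta$ (the successor of $\beta$). $\Lambda^{<\gamma}=\{\alpha\in\Lambda:\alpha<\gamma\}$. A family $(x_\alpha)_{\alpha\in\Lambda}$ in a normed space $E$, with $a=\min\Lambda$, is locally summable if to every $\gamma\in\Lambda$ there corresponds a unique element $\sigma(\gamma)\in E$, called the sum of $(x_\alpha)_{\alpha\in\Lambda^{<\gamma}}$, such that: (i) $\sigma(a)=0$, and if $\gamma=S(\beta)$ for some $\beta\in\Lambda$, then $\sigma(\gamma)=\sigma(\beta)+x_\beta$; (ii) if $\gamma>a$ is not a successor, then for each $\epsilon>0$ there is $\beta_\epsilon\in\Lambda^{<\gamma}$ such that $\|\sigma(\beta)-\sigma(\gamma)\|<\epsilon$ whenever $\beta\in\Lambda$ and $\beta_\epsilon\le\beta<\gamma$. A mapping $g:[c,d]\to E$ ($-\infty<c<d<\infty$) is HL (Henstock–Lebesgue) integrable if there is a mapping $F:[c,d]\to E$ such that for each $\epsilon>0$ there is $\delta:[c,d]\to(0,\infty)$ such that whenever $c=t_0<\dots<t_m=d$ and $\xi_i\in[t_{i-1},t_i]\subset(\xi_i-\delta(\xi_i),\xi_i+\delta(\xi_i))$ for $i=1,\dots,m$, then $\sum_{i=1}^m\|F(t_i)-F(t_{i-1})-g(\xi_i)(t_i-t_{i-1})\|<\epsilon$. Then $\int_c^dg(s)\,ds:=F(d)-F(c)$.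 A mapping on $[a,b)$ is locally HL integrable if it is HL integrable on every compact subinterval of $[a,b)$. *)

(* Defs.v *)
From mathcomp Require Import all_boot all_order all_algebra.
From mathcomp Require Import all_classical all_reals all_analysis.

Set Implicit Arguments.
Unset Strict Implicit.
Unset Printing Implicit Defensive.

Import Order.TTheory GRing.Theory Num.Theory.
Import numFieldNormedType.Exports.

Local Open Scope classical_set_scope.
Local Open Scope ring_scope.

(* Well ordered index sets are subsets of an arbitrary totally ordered type;
   this covers subsets of R as well as subsets of R extended with +oo. *)
Section WellOrderedSets.
Context (disp : Order.disp_t) (T : orderType disp).
Implicit Types (L : set T) (x y : T).

Definition is_least L x : Prop := L x /\ lbound L x.

Definition well_ordered L : Prop :=
  forall B : set T, B `<=` L -> B !=set0 -> exists x, is_least B x.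

Definition is_succ L x y : Prop := is_least (L `&` `]x, +oo[) y.

(* succ L x is the junk value x when x has no successor, so "y is a successor"
   must be stated with is_succ and not as y = succ L x. *)
Definition succ L x : T := xget x [set y | is_succ L x y].

End WellOrderedSets.

Section LocalSummability.
Context (disp : Order.disp_t) (T : orderType disp).
Context (R : realType) (E : normedModType R).
Implicit Types (L : set T) (x s : T -> E).

(* Families indexed by L are total functions whose values outside L are
   irrelevant; s c is the sum of the x i with i in L and i < c. *)
Definition is_local_sum L x s : Prop :=
  [/\ forall a, is_least L a -> s a = 0,
      forall b c, L b -> is_succ L b c -> s c = s b + x b
    & forall a c, is_least L a -> L c -> (a < c)%O ->
        ~ (exists2 b, L b & is_succ L b c) ->
        forall e : R, 0 < e ->
          exists2 b0, (L `&` `]-oo, c[) b0 &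
            forall b, L b -> (b0 <= b < c)%O -> `|s b - s c| < e].

Definition locally_summable L x : Prop :=
  exists s, is_local_sum L x s /\
    forall s', is_local_sum L x s' -> forall c, L c -> s' c = s c.

End LocalSummability.

Section HenstockLebesgue.
Context (R : realType) (E : normedModType R).
Implicit Types (g F : R -> E) (c d : R).

(* c = t 0 < ... < t m = d, the tag of [t i, t i.+1] being xi i; the values of
   t beyond m and of xi from m on are irrelevant. *)
Definition fine_tagged_partition (c d : R) (delta : R -> R)
    (m : nat) (t xi : nat -> R) : Prop :=
  [/\ t 0%N = c, t m = d
    & forall i, (i < m)%N ->
        [/\ t i < t i.+1, xi i \in `[t i, t i.+1]
          & [set` `[t i, t i.+1]] `<=`
            `]xi i - delta (xi i), xi i + delta (xi i)[ ] ].

Definition HL_primitive g c d F : Prop :=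
  forall e : R, 0 < e ->
  exists2 delta : R -> R, (forall u, u \in `[c, d] -> 0 < delta u) &
    forall m t xi, fine_tagged_partition c d delta m t xi ->
      \sum_(i < m) `|F (t i.+1) - F (t i) - (t i.+1 - t i) *: g (xi i)| < e.

Definition HL_integrable g c d : Prop := exists F, HL_primitive g c d F.

Definition HL_integral g c d : E :=
  xget 0 [set v | exists2 F, HL_primitive g c d F & v = F d - F c].

Definition co_itv (a : R) (b : \bar R) : set R :=
  [set t | (a%:E <= t%:E < b)%E].

Definition locally_HL_integrable g (a : R) (b : \bar R) : Prop :=
  forall c d, c < d -> [set` `[c, d]] `<=` co_itv a b -> HL_integrable g c d.

End HenstockLebesgue.

(* Main.v *)
Require Import Defs.
From mathcomp Require Import all_boot all_order all_algebra.
From mathcomp Require Import all_classical all_reals all_analysis.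
From mathcomp Require Import lra.

(** Let [f] be the polygonal mapping with [f t = s i + (t - i) *: z i] on the
    step [[i, succ L i[], where [s] is a local sum.  Condition (i) on local
    sums says that [f] is continuous at the successors, condition (ii) that it
    is left continuous at the other points of [L]; away from [L] it is locally
    affine with slope [g].  Thus [f] is a primitive of [g] apart from a
    well ordered set of corners, and the only task is to pay for the corners.
    At a corner [x] the defect [f x - f u - (x - u) *: g x] tends to 0 as [u]
    increases to [x], so a gauge makes it smaller than [e * (succ L x - x)].
    These prices are summable because the steps are disjoint: they are
    increments of the nondecreasing function [right_end] sending [t] to the
    right end of its step, which jumps by at least [succ L x - x] on every
    interval ]u, x] ending at [x].  [HL_primitive_dominated] turns
    such a domination of the defects by increments of a nondecreasing function
    into Henstock-Lebesgue integrability, and [HL_primitive_step_sum] applies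
    it.

    Conversely, when [g] is locally integrable, [HL_integral g a] is a local
    sum.  On a step [g] is constant up to the value at the right end, which
    gives the successor rule; at a limit point the rule is the left continuity
    of primitives.  Both use that increments of primitives are determined by
    the integrand and that primitives restrict to subintervals, two
    consequences of the existence of fine partitions ([cousin]).  Local sums
    are unique by well-founded induction along [L], and the formula for the
    integral is the value [f c - f a] with [f a = s a = 0]. *)

Import Order.TTheory GRing.Theory Num.Theory.
Import numFieldNormedType.Exports.
Local Open Scope classical_set_scope.
Local Open Scope ring_scope.

Set Implicit Arguments.
Unset Strict Implicit.
Unset Printing Implicit Defensive.

(** * Tagged partitions and Cousin's lemma *)

Section TaggedPartitions.
Context (R : realType).
Implicit Types (c d e u v x : R) (delta : R -> R) (t xi : nat -> R).

Definition splice (T : Type) (m : nat) (p q : nat -> T) (i : nat) : T :=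
  if (i < m)%N then p i else q (i - m)%N.

Lemma spliceDl (T : Type) m (p q : nat -> T) i : splice m p q (m + i)%N = q i.
Proof. by rewrite /splice ltnNge leq_addr /= addKn. Qed.

Lemma splice_le (T : Type) m (p q : nat -> T) i :
  p m = q 0%N -> (i <= m)%N -> splice m p q i = p i.
Proof.
move=> pq; rewrite /splice leq_eqVlt => /orP[/eqP->|->//].
by rewrite ltnn subnn.
Qed.

Lemma fine_tagged_partition_splice c d e (delta : R -> R) m t xi n t' xi' :
  fine_tagged_partition c d delta m t xi ->
  fine_tagged_partition d e delta n t' xi' ->
  fine_tagged_partition c e delta (m + n) (splice m t t') (splice m xi xi').
Proof.
move=> [t0 tm tP] [t'0 t'n t'P]; have tt' : t m = t' 0%N by rewrite tm t'0.
split; [by rewrite splice_le|by rewrite spliceDl|move=> i imn].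
have [im|mi] := ltnP i m.
  have -> : splice m xi xi' i = xi i by rewrite /splice im.
  by rewrite !(splice_le tt')// 1?ltnW//; exact: tP.
by rewrite -(subnKC mi) -addnS !spliceDl; apply: t'P; rewrite ltn_subLR.
Qed.

Lemma fine_tagged_partition1 u v x (delta : R -> R) :
  u < v -> u <= x <= v -> x - delta x < u -> v < x + delta x ->
  fine_tagged_partition u v delta 1 (fun i => if i is 0%N then u else v) (fun=> x).
Proof.
move=> uv uxv xu vx; split=> // -[|//] _; split=> //.
move=> w /=; rewrite !in_itv /= => /andP[uw wv].
by rewrite (lt_le_trans xu)//= (le_lt_trans wv).
Qed.

Lemma fine_tagged_partition_le_mem c d (delta : R -> R) m t xi :
  fine_tagged_partition c d delta m t xi ->
  forall i, (i <= m)%N -> c <= t i <= d.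
Proof.
move=> [t0 tm tP] i im; apply/andP; split.
  elim: i im => [_|i IH im]; first by rewrite t0.
  by have [lt_t _ _] := tP _ im; rewrite (le_trans (IH (ltnW im)))// ltW.
rewrite -(subKn im); elim: (m - i)%N (leq_subr i m) => [_|k IH km].
  by rewrite subn0 tm.
have km' : (m - k.+1 < m)%N by rewrite ltn_subrL /= (leq_trans _ km).
have [lt_t _ _] := tP _ km'.
by rewrite (le_trans (ltW lt_t))// -subSn// subSS IH// ltnW.
Qed.

(** The points [u] such that [[c, u]] has a fine partition have a supremum; the
    single interval around it allowed by the gauge both reaches it from the left
    and goes beyond it, so it is [d]. *)
Lemma cousin c d (delta : R -> R) : c <= d ->
  (forall u, u \in `[c, d] -> 0 < delta u) ->
  exists m t xi, fine_tagged_partition c d delta m t xi.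
Proof.
move=> cd delta0.
pose A : set R := [set u | c <= u <= d /\
  exists m t xi, fine_tagged_partition c u delta m t xi].
have Ac : A c.
  split; first by rewrite lexx.
  by exists 0%N, (fun=> c), (fun=> c); split.
have supA : has_sup A by split; [exists c|exists d => u [/andP[]]].
have extend u v x : A u -> c <= x <= d -> u <= x <= v -> v <= d ->
    x - delta x < u -> v < x + delta x -> A v.
  move=> [/andP[cu ud] [m [t [xi p]]]] xcd uxv vd xu vx.
  have /andP[ux xv] := uxv; have uv := le_trans ux xv.
  split; first by rewrite (le_trans cu).
  move: uv; rewrite le_eqVlt => /orP[/eqP <-|uv]; first by exists m, t, xi.
  have p1 := fine_tagged_partition1 uv uxv xu vx.
  by do 3 eexists; apply: fine_tagged_partition_splice p p1.
set s := sup A.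
have cs : c <= s by apply: ub_le_sup => //; case: supA.
have sd : s <= d by apply: ge_sup => [|u [/andP[]]//]; case: supA.
have ds : 0 < delta s by apply: delta0; rewrite in_itv /= cs.
have [u Au su] := sup_adherent ds supA.
have us : u <= s by apply: ub_le_sup => //; case: supA.
have As : A s.
  by apply: (extend u s s) => //; rewrite ?cs ?us ?lexx ?ltrDl.
have [->|sNd] := eqVneq d s; first by case: As.
have {}sd : s < d by rewrite lt_neqAle eq_sym sNd.
pose v := Num.min d (s + delta s / 2).
have sv : s < v by rewrite lt_min sd ltrDl divr_gt0.
(* Half of the gauge is used because fineness is a strict condition. *)
suff : v <= s by rewrite leNgt sv.
apply: ub_le_sup; first by case: supA.
apply: (extend u v s) => //.
- by rewrite cs ltW.
- by rewrite us ltW.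
- by rewrite ge_min lexx.
- by rewrite gt_min; apply/orP; right; rewrite ltrD2l; lra.
Qed.

End TaggedPartitions.

(** * Henstock sums, uniqueness and existence of primitives *)

Section HenstockSums.
Context (R : realType) (E : normedModType R).
Implicit Types (F G g : R -> E) (c d e u v x : R) (delta : R -> R).
Implicit Types (t xi : nat -> R).

Definition henstock_sum F g m t xi : R :=
  \sum_(i < m) `|F (t i.+1) - F (t i) - (t i.+1 - t i) *: g (xi i)|.

Lemma henstock_sum_ge0 F g m t xi : 0 <= henstock_sum F g m t xi.
Proof. exact: sumr_ge0. Qed.

Lemma henstock_sum_splice F g m t xi n t' xi' : t m = t' 0%N ->
  henstock_sum F g (m + n) (splice m t t') (splice m xi xi') =
  henstock_sum F g m t xi + henstock_sum F g n t' xi'.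
Proof.
move=> tt'; rewrite /henstock_sum big_split_ord /=; congr (_ + _).
  apply: eq_bigr => i _.
  have -> : splice m xi xi' i = xi i by rewrite /splice ltn_ord.
  by rewrite !(splice_le tt')// ltnW.
by apply: eq_bigr => i _; rewrite -addnS !spliceDl.
Qed.

(** The increments of [F] and [G] telescope along the partition, and the terms of
    [g] cancel in the difference. *)
Lemma henstock_sum_increment F G g c d delta m t xi :
  fine_tagged_partition c d delta m t xi ->
  `|(F d - F c) - (G d - G c)| <=
  henstock_sum F g m t xi + henstock_sum G g m t xi.
Proof.
move=> [t0 tm _].
have tel (K : R -> E) : K d - K c = \sum_(i < m) (K (t i.+1) - K (t i)).
  by rewrite -(big_mkord xpredT (fun i => K (t i.+1) - K (t i))) telescope_sumr// t0 tm.
rewrite !tel -sumrB /henstock_sum -big_split /=.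
apply: le_trans (ler_norm_sum _ _ _) _; apply: ler_sum => i _.
by apply: le_trans (ler_normB _ _); rewrite [in leRHS]opprB addrA subrK.
Qed.

Definition HL_gauge F g c d e delta : Prop :=
  (forall u, u \in `[c, d] -> 0 < delta u) /\
  forall m t xi, fine_tagged_partition c d delta m t xi ->
    henstock_sum F g m t xi < e.

(** A fine partition of the subinterval extends, by Cousin's lemma, to a fine
    partition of [[c, d]], and the extra terms of the sum are nonnegative.  The
    gauge itself is kept, so that it may be tested on arbitrarily small
    subintervals in [HL_gauge_local]. *)
Lemma HL_gauge_sub F g c d u v e delta : c <= u -> u <= v -> v <= d ->
  HL_gauge F g c d e delta -> HL_gauge F g u v e delta.
Proof.
move=> cu uv vd [delta0 small]; split=> [w|m t xi p].
  rewrite in_itv /= => /andP[uw wv]; apply: delta0.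
  by rewrite in_itv /= (le_trans cu)// (le_trans wv).
have pos w : c <= w <= d -> 0 < delta w by move=> cwd; apply: delta0; rewrite in_itv.
have [|m1 [t1 [xi1 p1]]] := @cousin R c u delta cu.
  move=> w; rewrite in_itv /= => /andP[cw wu].
  by rewrite pos// cw (le_trans wu)// (le_trans uv).
have [|m2 [t2 [xi2 p2]]] := @cousin R v d delta vd.
  move=> w; rewrite in_itv /= => /andP[vw wd].
  by rewrite pos// wd (le_trans cu)// (le_trans uv).
have tE : t m = t2 0%N by case: p => _ -> _; case: p2 => -> _ _.
have t1E : t1 m1 = splice m t t2 0.
  by rewrite splice_le//; case: p => -> _ _; case: p1 => _ -> _.
have := small _ _ _ (fine_tagged_partition_splice p1 (fine_tagged_partition_splice p p2)).
rewrite !henstock_sum_splice//.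
have := henstock_sum_ge0 F g m1 t1 xi1; have := henstock_sum_ge0 F g m2 t2 xi2.
lra.
Qed.

Lemma HL_primitive_sub F g c d u v : c <= u -> u <= v -> v <= d ->
  HL_primitive g c d F -> HL_primitive g u v F.
Proof.
move=> cu uv vd primF e /primF[delta delta0 small].
by have [delta0' small'] := HL_gauge_sub cu uv vd (conj delta0 small); exists delta.
Qed.

(** A single interval is a fine partition of itself. *)
Lemma HL_gauge_local F g c d e delta u v x :
  HL_gauge F g c d e delta -> c <= u -> u < v -> v <= d -> u <= x <= v ->
  x - delta x < u -> v < x + delta x ->
  `|F v - F u - (v - u) *: g x| < e.
Proof.
move=> gauge cu uv vd uxv xu vx.
have [_ /(_ _ _ _ (fine_tagged_partition1 uv uxv xu vx))] :=
  HL_gauge_sub cu (ltW uv) vd gauge.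
by rewrite /henstock_sum big_ord1.
Qed.

(** Tag the last interval by [d]; its term of the Riemann sum is small with its
    length. *)
Lemma HL_primitive_left_continuous F g c d : c < d -> HL_primitive g c d F ->
  forall e, 0 < e -> exists2 u, c <= u < d &
    forall v, u <= v < d -> `|F v - F d| < e.
Proof.
move=> cd primF e e0; have e20 : 0 < e / 2 by rewrite divr_gt0.
have [delta delta0 small] := primF _ e20.
have dd : 0 < delta d by apply: delta0; rewrite in_itv /= lexx ltW.
have ng0 : 0 < `|g d| + 1 by rewrite ltr_wpDl.
(* The added 1 keeps the divisor positive when [g d = 0]. *)
pose r := Num.min (delta d / 2) (e / 2 / (`|g d| + 1)).
have r0 : 0 < r by rewrite lt_min !divr_gt0.
exists (Num.max c (d - r)).
  by rewrite le_max lexx /= gt_max cd ltrBlDr ltrDl.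
move=> v; rewrite ge_max -andbA => /and3P[cv rv vd].
have rdelta : r <= delta d / 2 by rewrite ge_min lexx.
have := HL_gauge_local (conj delta0 small) cv vd (lexx d) (u := v) (v := d) (x := d).
have -> : v <= d <= d by rewrite ltW//=.
move=> /(_ isT) H.
have {}H : `|F d - F v - (d - v) *: g d| < e / 2 by apply: H; lra.
have small2 : `|(d - v) *: g d| <= e / 2.
  rewrite normrZ gtr0_norm ?subr_gt0//.
  rewrite -[leRHS](divfK (lt0r_neq0 ng0)).
  apply: ler_pM; rewrite ?subr_ge0 ?(ltW vd)//; last by rewrite lerDl.
  rewrite lerBlDr -lerBlDl (le_trans _ rv)// lerD2l lerN2.
  by rewrite ge_min lexx orbT.
rewrite distrC -[F d - F v](subrK ((d - v) *: g d)).
by apply: le_lt_trans (ler_normD _ _) _; rewrite (splitr e) ltr_leD.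
Qed.

(** A partition fine for the minimum of two gauges is fine for both. *)
Lemma HL_primitive_increment F G g c d : c <= d ->
  HL_primitive g c d F -> HL_primitive g c d G -> F d - F c = G d - G c.
Proof.
move=> cd primF primG; apply/eqP; rewrite -subr_eq0 -normr_le0.
apply/ler_addgt0Pl => e e0; rewrite addr0.
have e20 : 0 < e / 2 by rewrite divr_gt0.
have [deltaF deltaF0 smallF] := primF _ e20.
have [deltaG deltaG0 smallG] := primG _ e20.
pose delta x := Num.min (deltaF x) (deltaG x).
have [|m [t [xi p]]] := @cousin R c d delta cd.
  by move=> u ucd; rewrite lt_min deltaF0 ?deltaG0.
have weaken (delta' : R -> R) : (forall x, delta x <= delta' x) ->
    fine_tagged_partition c d delta' m t xi.
  case: p => t0 tm tP le_delta; split=> // i /tP[lt_t tag fine]; split=> //.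
  apply: subset_trans fine _ => w /=; rewrite !in_itv /= => /andP[xw wx].
  by have := le_delta (xi i); lra.
apply: le_trans (henstock_sum_increment F G g p) _.
rewrite (splitr e) lerD// ltW//.
  by apply: smallF; apply: weaken => x; rewrite ge_min lexx.
by apply: smallG; apply: weaken => x; rewrite ge_min lexx orbT.
Qed.

Lemma HL_integralE F g c d : c <= d -> HL_primitive g c d F ->
  HL_integral g c d = F d - F c.
Proof.
move=> cd primF; apply: xget_unique; first by exists F.
by move=> _ [G primG ->]; exact: HL_primitive_increment primG primF.
Qed.

(** The local bounds add up over a partition, since the increments of [H]
    telescope to [H d - H c].  As [H] may jump, this allows for points where
    [F] is not differentiable. *)
Lemma HL_primitive_dominated F g c d (H : R -> R) :
  (forall u v, c <= u -> u <= v -> v <= d -> H u <= H v) ->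
  (forall e x, 0 < e -> c <= x <= d ->
     exists2 r, 0 < r & forall u v, c <= u -> u <= x <= v -> v <= d ->
       x - r < u -> v < x + r ->
       `|F v - F u - (v - u) *: g x| <= e * (H v - H u)) ->
  HL_primitive g c d F.
Proof.
move=> mH domF e e0.
pose eta := e / (1 + `|H d - H c|).
have den0 : 0 < 1 + `|H d - H c| by rewrite ltr_pwDl.
have eta0 : 0 < eta by rewrite divr_gt0.
have /choice[delta deltaP] : forall x, exists r, x \in `[c, d] -> 0 < r /\
    forall u v, c <= u -> u <= x <= v -> v <= d -> x - r < u -> v < x + r ->
       `|F v - F u - (v - u) *: g x| <= eta * (H v - H u).
  move=> x; have [xcd|_] := boolP (x \in `[c, d]); last by exists 0.
  by have [|r r0 rP] := domF _ x eta0; [rewrite in_itv in xcd|exists r].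
exists delta => [u /deltaP[]//|m t xi p].
have mem := fine_tagged_partition_le_mem p; case: p => t0 tm tP.
apply: (@le_lt_trans _ _ (\sum_(i < m) eta * (H (t i.+1) - H (t i)))).
  apply: ler_sum => i _; have [lt_t tag fine] := tP i (ltn_ord i).
  have /andP[ct _] := mem i (ltnW (ltn_ord i)).
  have /andP[_ td] := mem i.+1 (ltn_ord i).
  move: tag; rewrite in_itv /= => /andP[tx xt].
  have [|_] := deltaP (xi i); first by rewrite in_itv /= (le_trans ct)// (le_trans xt).
  have /fine : (`[t i, t i.+1])%classic (t i) by rewrite /= in_itv /= lexx ltW.
  have /fine : (`[t i, t i.+1])%classic (t i.+1) by rewrite /= in_itv /= lexx ltW.
  rewrite /= !in_itv /= => /andP[_ txd] /andP[dxt _]; apply => //.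
  by rewrite tx.
rewrite -mulr_sumr -(big_mkord xpredT (fun i => H (t i.+1) - H (t i))).
rewrite telescope_sumr// t0 tm /eta mulrAC ltr_pdivrMr//.
by rewrite ltr_pM2l// (le_lt_trans (ler_norm _))// ltrDr.
Qed.

End HenstockSums.

(** * Uniqueness of local sums *)

(** At the least point where two local sums differ both are determined by their
    values at earlier points, whether that point is the minimum, a successor or
    a limit. *)
Lemma local_sum_unique (disp : Order.disp_t) (T : orderType disp)
    (R : realType) (E : normedModType R) (L : set T) (x s s' : T -> E) :
  well_ordered L -> is_local_sum L x s -> is_local_sum L x s' ->
  forall c, L c -> s' c = s c.
Proof.
move=> Lwo [s0 sS slim] [s'0 s'S s'lim].
suff noneq : ~ (exists c, L c /\ s' c <> s c).
  by move=> c Lc; apply: contrapT => neq; apply: noneq; exists c.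
move=> neq; have [|c [[Lc scN] cmin]] := Lwo [set c | L c /\ s' c <> s c] _ neq.
  by move=> c [].
have below k : L k -> (k < c)%O -> s' k = s k.
  move=> Lk kc; apply: contrapT => skN.
  by have := cmin k (conj Lk skN); rewrite leNgt kc.
apply: scN; have [a leasta] := Lwo L (fun _ Lk => Lk) (ex_intro _ c Lc).
have [La amin] := leasta.
have := amin c Lc; rewrite le_eqVlt => /orP[/eqP <-|ac]; first by rewrite s0 ?s'0.
have [[k Lk kc]|Nsucc] := pselect (exists2 k, L k & is_succ L k c).
  rewrite (sS k c Lk kc) (s'S k c Lk kc) below//.
  by case: kc => -[_] /=; rewrite in_itv /= andbT.
apply/eqP; rewrite -subr_eq0 -normr_le0; apply/ler_addgt0Pl => e e0.
have e20 : 0 < e / 2 by rewrite divr_gt0.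
have [k [Lk]] := slim a c leasta Lc ac Nsucc _ e20.
have [k' [Lk']] := s'lim a c leasta Lc ac Nsucc _ e20.
rewrite /= !in_itv /= => k'c s'k kc sk.
pose m := Order.max k k'.
have Lm : L m by rewrite /m /Order.max; case: ifP.
have mc : (m < c)%O by rewrite gt_max kc.
have sm : `|s m - s c| < e / 2 by apply: sk => //; rewrite mc le_max lexx.
have s'm : `|s' m - s' c| < e / 2.
  by apply: s'k => //; rewrite mc le_max lexx orbT.
have -> : s' c - s c = (s m - s c) - (s' m - s' c).
  by rewrite (below m Lm mc) opprB [RHS]addrC addrA subrK.
by rewrite addr0 (le_trans (ler_normB _ _))// (splitr e) lerD// ltW.
Qed.

(** * Step mappings over a well ordered set *)

(** The value of [g] at [d] is arbitrary, which matters in the application where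
    [d] starts the next step.  It is charged to the unit jump at [d] of the
    dominating function. *)
Lemma HL_primitive_constant (R : realType) (E : normedModType R) (g : R -> E)
    (w : E) (c d : R) :
  (forall t, c <= t < d -> g t = w) -> HL_primitive g c d (fun t => t *: w).
Proof.
move=> gw; apply: (@HL_primitive_dominated _ _ _ _ _ _ (fun t => (d <= t)%R%:R)).
  move=> u v _ uv vd; rewrite ler_nat; have [du|//] := leP d u.
  by rewrite (le_trans du).
move=> e x e0 /andP[cx]; rewrite le_eqVlt => /orP[/eqP ->|xd]; last first.
  exists (d - x); rewrite ?subr_gt0// => u v _ uxv vd _ vxd.
  have {}vd : v < d by lra.
  rewrite gw ?cx// scalerBl subrr normr0 mulr_ge0// ?(ltW e0)// subr_ge0 ler_nat.
  by rewrite leNgt (le_lt_trans _ vd)//; lra.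
have den0 : 0 < `|w - g d| + 1 by rewrite ltr_wpDl.
exists (e / (`|w - g d| + 1)) => [|u v _ /andP[ud dv] vd rud _].
  by rewrite divr_gt0.
have {dv vd} -> : v = d by apply/eqP; rewrite eq_le vd.
rewrite -scalerBl -scalerBr lexx.
move: ud; rewrite le_eqVlt => /orP[/eqP ->|ud].
  by rewrite !subrr scale0r normr0 lexx subrr mulr0.
rewrite [d <= u]leNgt ud subr0 mulr1 normrZ gtr0_norm ?subr_gt0//.
rewrite -[leRHS](divfK (lt0r_neq0 den0)).
by apply: ler_pM; rewrite ?subr_ge0 ?(ltW ud) ?lerDl//; lra.
Qed.

Section StepMapping.
Context (R : realType) (E : normedModType R) (a : R) (b : \bar R) (L : set R).
Context (Lab : L `<=` co_itv a b) (Lwo : well_ordered L) (Lmin : is_least L a)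
        (Lcover : co_itv a b = \bigcup_(i in L) [set` `[i, succ L i[]).
Context (z g : R -> E)
        (gstep : forall i t, L i -> t \in `[i, succ L i[ -> g t = z i).
Implicit Types (i j t u v x e : R).

Lemma is_succE i j : is_succ L i j <->
  [/\ L j, i < j & forall k, L k -> i < k -> j <= k].
Proof.
split=> [[[Lj ij] jmin]|[Lj ij jmin]].
  move: ij; rewrite /= in_itv /= andbT => ij; split=> // k Lk ik.
  by apply: jmin; split=> //=; rewrite in_itv /= ik.
split; first by split=> //=; rewrite in_itv /= ij.
by move=> k [Lk] /=; rewrite in_itv /= andbT; exact: jmin.
Qed.

(** A maximum of [L] would have an empty step, and earlier steps end before it, so
    it would escape the covering. *)
Lemma is_succ_succ i : L i -> is_succ L i (succ L i).
Proof.
move=> Li; have /= := Lab Li.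
rewrite -/(co_itv a b i) Lcover => -[j Lj] /=; rewrite in_itv /= => /andP[ji ij].
have succj : is_succ L j (succ L j).
  rewrite /succ in ij *; case: xgetP ij => [y -> //|_].
  by rewrite ltNge ji.
suff -> : i = j by [].
apply/eqP; rewrite eq_le ji andbT leNgt; apply/negP => lt_ji.
have /is_succE[_ _ /(_ i Li lt_ji)] := succj.
by rewrite leNgt ij.
Qed.

Lemma succ_in i : L i -> L (succ L i).
Proof. by move=> /is_succ_succ/is_succE[]. Qed.

Lemma succ_gt i : L i -> i < succ L i.
Proof. by move=> /is_succ_succ/is_succE[]. Qed.

Lemma succ_le i j : L i -> L j -> i < j -> succ L i <= j.
Proof. by move=> /is_succ_succ/is_succE[_ _ le_succ] Lj; exact: le_succ. Qed.

Lemma is_succ_eq i j : L i -> is_succ L i j -> j = succ L i.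
Proof.
move=> Li /is_succE[Lj ij jmin]; apply/eqP.
by rewrite eq_le jmin ?succ_le ?succ_gt//; exact: succ_in.
Qed.

Definition left_end t : R := xget a [set i | L i /\ i <= t < succ L i].

Lemma left_endP t : co_itv a b t ->
  L (left_end t) /\ left_end t <= t < succ L (left_end t).
Proof.
rewrite Lcover => -[i Li /=]; rewrite in_itv /= => it.
by apply: (@xgetPex _ a [set i | L i /\ i <= t < succ L i]); exists i.
Qed.

Lemma left_end_unique i t : L i -> i <= t < succ L i -> left_end t = i.
Proof.
move=> Li it; apply: xget_unique => // j [Lj /andP[jt tj]].
case/andP: it => it ti.
apply/eqP; rewrite eq_le !leNgt; apply/andP; split; apply/negP => lt.
  by have := succ_le Li Lj lt; lra.
by have := succ_le Lj Li lt; lra.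
Qed.

Definition right_end t : R := succ L (left_end t).

Lemma right_end_le u v : co_itv a b u -> co_itv a b v -> u <= v ->
  right_end u <= right_end v.
Proof.
move=> /left_endP[Li /andP[iu ui]] /left_endP[Lj /andP[jv vj]] uv.
rewrite /right_end in vj *; have [le_v|lt_v] := leP (succ L (left_end u)) v.
  by rewrite ltW// (le_lt_trans le_v).
by rewrite (@left_end_unique (left_end u) v)// lt_v (le_trans iu).
Qed.

Lemma right_end_id i : L i -> right_end i = succ L i.
Proof. by move=> Li; rewrite /right_end (@left_end_unique i)// lexx succ_gt. Qed.

(** With [right_end_id], this bounds the jump of [right_end] at [i] from below by
    the length of the step starting at [i]. *)
Lemma right_end_jump i u : co_itv a b u -> L i -> u < i -> right_end u <= i.
Proof.
move=> /left_endP[Lj /andP[ju _]] Li ui.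
by rewrite /right_end succ_le// (le_lt_trans ju).
Qed.

Section Primitive.
Context (s f : R -> E).
Context (ssum : is_local_sum L (fun i => (succ L i - i) *: z i) s).
Context (fE : forall i t, L i -> t \in `[i, succ L i[ ->
                f t = s i + (t - i) *: z i).

Lemma primitive_id i : L i -> f i = s i.
Proof.
by move=> Li; rewrite (fE Li) ?in_itv /= ?lexx ?succ_gt// subrr scale0r addr0.
Qed.

(** The right end of the step is included, by the successor rule for [s]. *)
Lemma primitive_affine i t : L i -> i <= t <= succ L i -> f t = s i + (t - i) *: z i.
Proof.
move=> Li /andP[it]; rewrite le_eqVlt => /orP[/eqP ->|ti]; last first.
  by rewrite (fE Li)// in_itv /= it.
rewrite primitive_id; last exact: succ_in.
by case: ssum => _ sS _; rewrite (sS i)//; exact: is_succ_succ.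
Qed.

Lemma primitive_increment i u v : L i -> i <= u <= succ L i -> i <= v <= succ L i ->
  f v - f u = (v - u) *: z i.
Proof.
move=> Li iu iv; rewrite !(primitive_affine Li)// opprD addrACA subrr add0r.
by rewrite -scalerBl opprB addrA subrK.
Qed.

(** On a step [f] interpolates between the values of [s] at the two ends.  This
    transfers the limit rule for [s] from [L] to all points. *)
Lemma primitive_convex i t y e : L i -> i <= t <= succ L i ->
  `|s i - y| < e -> `|s (succ L i) - y| < e -> `|f t - y| < e.
Proof.
move=> Li it near_i near_S; have /andP[it1 it2] := it.
have d0 : 0 < succ L i - i by rewrite subr_gt0 succ_gt.
pose p := (t - i) / (succ L i - i).
have p0 : 0 <= p by rewrite divr_ge0 ?(ltW d0) ?subr_ge0.
have p1 : p <= 1 by rewrite /p ler_pdivrMr// mul1r lerD2r.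
have -> : f t - y = (1 - p) *: (s i - y) + p *: (s (succ L i) - y).
  rewrite (primitive_affine Li it); case: ssum => _ sS _.
  rewrite (sS i _ Li (is_succ_succ Li)) !(addrAC (s i) (_ *: z i)).
  rewrite (scalerDr p (s i - y)) addrA.
  rewrite -scalerDl subrK scale1r scalerA /p divfK//.
  by rewrite gt_eqF.
clearbody p; apply: le_lt_trans (ler_normD _ _) _; rewrite !normrZ !ger0_norm ?subr_ge0//.
set A := `|s i - y| in near_i *; set B := `|s _ - y| in near_S *.
clearbody A B; have [AB|BA] := leP A B.
  by apply: le_lt_trans near_S; nra.
by apply: le_lt_trans near_i; nra.
Qed.

(** At a limit point [x] every step starting before [x] also ends before [x], so
    both ends of a late enough step are points where [s] is close to [s x]. *)
Lemma primitive_left_continuous x e : L x -> a < x -> 0 < e ->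
  exists2 u, a <= u < x & forall v, u <= v < x -> `|f v - f x| < e.
Proof.
move=> Lx ax e0; have [La amin] := Lmin.
have [[j Lj jx]|Nsucc] := pselect (exists2 j, L j & is_succ L j x).
  have xE := is_succ_eq Lj jx.
  have jx' : j < x by rewrite xE succ_gt.
  have den0 : 0 < `|z j| + 1 by rewrite ltr_wpDl.
  have r0 : 0 < e / (`|z j| + 1) by rewrite divr_gt0.
  exists (Num.max j (x - e / (`|z j| + 1))) => [|v].
    by rewrite le_max amin//= gt_max jx' /=; lra.
  rewrite ge_max -andbA => /and3P[jv rv vx].
  rewrite distrC (@primitive_increment j)// -?xE ?jv ?(ltW vx) ?(ltW jx') ?lexx//.
  rewrite normrZ gtr0_norm ?subr_gt0//.
  apply: (@le_lt_trans _ _ (e / (`|z j| + 1) * `|z j|)).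
    by rewrite ler_wpM2r//; lra.
  by rewrite mulrAC ltr_pdivrMr// ltr_pM2l// ltrDl.
have [_ _ /(_ a x Lmin Lx ax Nsucc e e0)[k [Lk]]] := ssum.
rewrite /= in_itv /= => kx near_k.
exists k => [|v /andP[kv vx]]; first by rewrite amin.
have vab : co_itv a b v.
  have /= /andP[_ xb] := Lab Lx; rewrite /co_itv /=.
  by rewrite lee_fin (le_trans (amin _ Lk))//= (lt_trans _ xb)// lte_fin.
have [Li /andP[iv vi]] := left_endP vab; set i := left_end v in Li iv vi.
have ki : k <= i.
  by rewrite leNgt; apply/negP => ik; have := succ_le Li Lk ik; lra.
have ix : i < x by lra.
have Six : succ L i < x.
  rewrite lt_neqAle succ_le// andbT; apply/eqP => Sx; apply: Nsucc.
  by exists i; rewrite // -Sx; exact: is_succ_succ.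
rewrite (primitive_id Lx); apply: (@primitive_convex i) => //; first by rewrite iv ltW.
  by apply: near_k; rewrite ?ki.
apply: near_k; first exact: succ_in.
by rewrite Six (le_trans ki)// ltW// succ_gt.
Qed.

(** Inside a step the defect vanishes.  At a point [x] of [L] only the part of the
    interval to the left of [x] contributes, and when it is nonempty
    [right_end] grows by at least [succ L x - x] over it. *)
Lemma HL_primitive_step_sum c d : a <= c -> (d%:E < b)%E -> HL_primitive g c d f.
Proof.
move=> ac db.
have mem x : c <= x <= d -> co_itv a b x.
  move=> /andP[cx xd]; rewrite /co_itv /= lee_fin (le_trans ac)//=.
  by rewrite (le_lt_trans _ db)// lee_fin.
apply: (@HL_primitive_dominated _ _ _ _ _ _ right_end) => [u v cu uv vd|].
  by apply: right_end_le => //; apply: mem; lra.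
move=> e x e0 xcd; have /mem/left_endP[Li /andP[ix xi]] := xcd.
set i := left_end x in Li ix xi.
have gx : g x = z i by apply: gstep => //; rewrite in_itv /= ix.
have rhs_ge0 u v : c <= u -> u <= x <= v -> v <= d ->
    0 <= e * (right_end v - right_end u).
  move=> cu uxv vd; rewrite mulr_ge0 ?(ltW e0)// subr_ge0.
  by apply: right_end_le; [apply: mem; lra|apply: mem; lra|lra].
move: ix; rewrite le_eqVlt => /orP[/eqP ix|ix]; last first.
  exists (Num.min (x - i) (succ L i - x)).
    by rewrite lt_min !subr_gt0 ix.
  move=> u v cu uxv vd; rewrite ltrBlDr -ltrBlDl -ltrBlDl !lt_min.
  move=> /andP[ui uS] /andP[vi vS].
  rewrite (@primitive_increment i) ?gx; [|by []|by lra|by lra].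
  by rewrite subrr normr0 rhs_ge0.
have Lx : L x by rewrite -ix.
have gap0 : 0 < succ L x - x by rewrite subr_gt0 succ_gt.
rewrite ix in gx.
(* Half of the price of the corner [x] goes to the increment of [f], the other
   half to the linear term. *)
pose k := e * (succ L x - x) / 2.
have k0 : 0 < k by rewrite divr_gt0// mulr_gt0.
have den0 : 0 < `|z x| + 1 by rewrite ltr_wpDl.
have [u0 u0x near_x] : exists2 u0, u0 < x &
    forall u, c <= u -> u0 <= u < x -> `|f u - f x| < k.
  have [_ amin] := Lmin.
  have := amin x Lx; rewrite le_eqVlt => /orP[/eqP ax|ax].
    (* No point of [c, d] lies to the left of [x = a]. *)
    exists (x - 1); first by lra.
    by move=> u cu; lra.
  by have [u0 /andP[_ ?] ?] := primitive_left_continuous Lx ax k0; exists u0 => // u _; auto.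
exists (Num.min (succ L x - x) (Num.min (x - u0) (k / (`|z x| + 1)))).
  by rewrite !lt_min gap0 subr_gt0 u0x divr_gt0.
move=> u v cu uxv vd; rewrite ltrBlDr -ltrBlDl -ltrBlDl !lt_min.
move=> /and3P[_ uu0 uk] /andP[vS _]; have /andP[ux xv] := uxv.
have -> : f v - f u - (v - u) *: g x = (f x - f u) - (x - u) *: z x.
  have fv : f v = f x + (v - x) *: z x.
    by rewrite -(@primitive_increment x x v) ?[_ + (_ - _)]addrC ?subrK//; lra.
  have -> : v - u = (v - x) + (x - u) by rewrite addrA subrK.
  rewrite gx fv (scalerDl (z x) (v - x)) opprD addrA; congr (_ - _).
  by rewrite addrAC addrK.
move: ux; rewrite le_eqVlt => /orP[/eqP ux|ux].
  by rewrite {1 2}ux !subrr scale0r subr0 normr0 rhs_ge0.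
apply: (@le_trans _ _ (k + k)); last first.
  rewrite -splitr ler_pM2l// lerB//.
    by rewrite -(right_end_id Lx) right_end_le//; apply: mem; lra.
  by rewrite right_end_jump//; apply: mem; lra.
apply: le_trans (ler_normB _ _) _; rewrite lerD//.
  by rewrite distrC ltW// near_x// ux andbT; lra.
rewrite normrZ gtr0_norm ?subr_gt0// -[leRHS](divfK (lt0r_neq0 den0)).
by apply: ler_pM; rewrite ?subr_ge0 ?(ltW ux) ?lerDl//; lra.
Qed.

End Primitive.

(** At a point [c] of [L] all earlier values of the integral are read off one
    primitive on [[a, c]]. *)
Lemma local_sum_HL_integral : locally_HL_integrable g a b ->
  is_local_sum L (fun i => (succ L i - i) *: z i) (HL_integral g a).
Proof.
move=> gint; have [La amin] := Lmin.
have prim c : L c -> a < c -> exists F, HL_primitive g a c F.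
  move=> Lc ac; apply: gint => // t /=; rewrite in_itv /= => /andP[a_t tc].
  have /= /andP[_ cb] := Lab Lc; rewrite /co_itv /= lee_fin a_t /=.
  by rewrite (le_lt_trans _ cb)// lee_fin.
have integralE c F u : HL_primitive g a c F -> a <= u <= c ->
    HL_integral g a u = F u - F a.
  move=> primF /andP[au uc]; apply: HL_integralE => //.
  exact: HL_primitive_sub primF.
split.
- move=> a' [La' a'min]; have -> : a' = a.
    by apply/eqP; rewrite eq_le a'min ?amin.
  rewrite (@HL_integralE _ _ (fun=> 0)) ?subrr// => e e0.
  (* A partition of the degenerate interval has no subinterval. *)
  exists (fun=> 1) => // m t xi p; have [t0 tm tP] := p.
  case: m p tm tP => [|m] p tm tP; first by rewrite big_ord0.
  have [//|lt_t _ _] := tP 0%N.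
  have /andP[_] := fine_tagged_partition_le_mem p (isT : (1 <= m.+1)%N).
  by rewrite -t0 leNgt lt_t.
- move=> i c Li /(is_succ_eq Li) ->.
  have iS := succ_gt Li; have ai := amin _ Li.
  have [F primF] := prim _ (succ_in Li) (le_lt_trans ai iS).
  rewrite (integralE _ _ _ primF) ?lexx ?(le_trans ai (ltW iS))//.
  rewrite (integralE _ _ _ primF) ?ai ?ltW//.
  have primi := HL_primitive_sub ai (ltW iS) (lexx _) primF.
  have gi t : i <= t < succ L i -> g t = z i.
    by move=> it; apply: gstep => //; rewrite in_itv.
  have := HL_primitive_increment (ltW iS) primi (HL_primitive_constant gi).
  by rewrite -scalerBl => <-; rewrite [RHS]addrC addrA subrK.
- move=> a' c [La' a'min] Lc a'c Nsucc e e0.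
  have ac : a < c by rewrite (le_lt_trans _ a'c)// amin.
  have [F primF] := prim _ Lc ac.
  have [u /andP[au uc] near_c] := HL_primitive_left_continuous ac primF e0.
  have uab : co_itv a b u.
    have /= /andP[_ cb] := Lab Lc; rewrite /co_itv /= lee_fin au /=.
    by rewrite (lt_trans _ cb)// lte_fin.
  have [Li /andP[iu ui]] := left_endP uab.
  (* The step containing [u] ends strictly before [c], which is not a successor. *)
  exists (succ L (left_end u)).
    split; first exact: succ_in.
    rewrite /= in_itv /= lt_neqAle succ_le ?(le_lt_trans iu)// andbT.
    apply/eqP => Sc; apply: Nsucc; exists (left_end u) => //.
    by rewrite -Sc; exact: is_succ_succ.
  move=> k Lk /andP[Sk kc].
  rewrite !(integralE _ _ _ primF) ?lexx ?(ltW ac) ?amin ?ltW//.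
  rewrite opprB addrA subrK near_c// kc andbT.
  by rewrite (le_trans _ Sk)// ltW.
Qed.

End StepMapping.

Theorem proposition3p2 (R : realType) (E : completeNormedModType R)
    (a : R) (b : \bar R) (ab : (a%:E < b)%E)
    (L : set R) (Lab : L `<=` co_itv a b) (Lwo : well_ordered L)
    (Lmin : is_least L a) (Lsup : ereal_sup (EFin @` L) = b)
    (Lcover : co_itv a b = \bigcup_(i in L) [set` `[i, succ L i[])
    (Ldisj : trivIset L (fun i => [set` `[i, succ L i[]))
    (z : R -> E) (g : R -> E)
    (gstep : forall i t, L i -> t \in `[i, succ L i[ -> g t = z i) :
  (locally_HL_integrable g a b <->
   locally_summable L (fun i => (succ L i - i) *: z i)) /\
  (locally_HL_integrable g a b \/
   locally_summable L (fun i => (succ L i - i) *: z i) ->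
   forall (s : R -> E),
     is_local_sum L (fun i => (succ L i - i) *: z i) s ->
   forall (f : R -> E),
     (forall i t, L i -> t \in `[i, succ L i[ -> f t = s i + (t - i) *: z i) ->
   forall c : R, a < c -> (c%:E < b)%E -> HL_integral g a c = f c).
Proof.
split; [split=> [gint|[s [ssum _]] c d cd cdab]|].
- have ssum := local_sum_HL_integral Lab Lmin Lcover gstep gint.
  by exists (HL_integral g a); split=> // s' s'sum; exact: (local_sum_unique Lwo ssum s'sum).
- pose i := left_end a L.
  exists (fun t => s (i t) + (t - i t) *: z (i t)).
  have /andP[ac _] : co_itv a b c by apply: cdab; rewrite /= in_itv /= lexx ltW.
  have /andP[_ db] : co_itv a b d by apply: cdab; rewrite /= in_itv /= lexx ltW.
  apply: (HL_primitive_step_sum Lab Lmin Lcover gstep ssum) => //.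
  move=> j t Lj; rewrite in_itv /= => jt.
  by rewrite /i (left_end_unique Lab Lcover Lj jt).
- move=> _ s ssum f fE c ac cb; have [La _] := Lmin.
  have primf := HL_primitive_step_sum Lab Lmin Lcover gstep ssum fE (lexx a) cb.
  rewrite (HL_integralE (ltW ac) primf).
  by case: ssum => s0 _ _; rewrite (primitive_id Lab Lcover fE La) s0// subr0.
Qed.
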